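(* Let $(R,\mathfrak{m})$ be a finite commutative local ring with identity and residue field $R/\mathfrak{m}\simeq\mathbb{F}_q$, where $q$ is a power of a prime $p$. Let $k\in\mathbb{N}$ be such that $(k,|R|)=1$. Then: (a) $-1\in U_R(k)$ if and only if $-1\in U_{R/\mathfrak{m}}(k)$. In particular, $-1\in U_R(k)$ if and only if $q$ is even, or else $q$ is odd and $(k,q-1)\mid\frac{q-1}{2}$. (b) $G_R(k)$ is undirected if and only if $G_{R/\mathfrak{m}}(k)$ is undirected. (c) $G_R(k)$ is connected if and only if $\frac{q-1}{(k,q-1)}\dagger q-1$.
   Context: $(a,b)$ denotes the greatest common divisor. For a commutative ring $A$ with identity with unit group $A^*$, $U_A(k)=\{x^k:x\in A^*\}$ and $G_A(k)=Cay(A,U_A(k))$ is the graph with vertex set $A$ and an arc from $v$ to $w$ iff $w-v\in U_A(k)$; it is called undirected when $U_A(k)=-U_A(k)$, and directed otherwise. A directed graph is connected if there is a directed walk from any vertex to any other vertex. For $q=p^m$ with $p$ prime, $n\dagger q-1$ means that $n$ is a primitive divisor of $p^m-1$: $n\mid p^m-1$ and $n\nmid p^a-1$ for all $1\le a<m$. *)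

(* Defs.v *)
From HB Require Import structures.
From mathcomp Require Import all_boot all_order all_algebra all_field.
From mathcomp Require Export ring_quotient.
From Stdlib Require Export Relation_Operators.

Set Implicit Arguments.
Unset Strict Implicit.
Unset Printing Implicit Defensive.

Import GRing.Theory.
Local Open Scope ring_scope.

(* [GRing.unit] is not used because [{ideal_quot I}] has no canonical
   [unitRingType] structure. *)
Definition is_unit (A : comPzRingType) (x : A) : Prop := exists y : A, y * x = 1.

Definition unit_powers (A : comPzRingType) (k : nat) (u : A) : Prop :=
  exists2 x : A, is_unit x & u = x ^+ k.

Definition cayley (A : zmodType) (S : A -> Prop) (v w : A) : Prop := S (w - v).

Definition gpaley (A : comPzRingType) (k : nat) : A -> A -> Prop :=
  cayley (@unit_powers A k).

Definition gpaley_undirected (A : comPzRingType) (k : nat) : Prop :=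
  forall x : A, unit_powers k x <-> exists2 u : A, unit_powers k u & x = - u.

Definition strongly_connected (V : Type) (arc : V -> V -> Prop) : Prop :=
  forall v w : V, clos_refl_trans V arc v w.

(* [idealr_closed] already requires the ideal to be proper. *)
Definition maximal_ideal (R : comNzRingType) (I : {pred R}) : Prop :=
  idealr_closed I /\
  forall J : {pred R}, idealr_closed J -> {subset I <= J} -> J =i I.

Definition local_ring (R : comNzRingType) (m : {pred R}) : Prop :=
  maximal_ideal m /\ forall J : {pred R}, maximal_ideal J -> J =i m.

Definition primitive_divisor (n p m : nat) : Prop :=
  (n %| p ^ m - 1)%N /\ forall a : nat, (1 <= a < m)%N -> ~~ (n %| p ^ a - 1)%N.

(* Main.v *)
Require Import Defs.
From mathcomp Require Import all_boot all_order all_algebra all_field.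
From mathcomp Require Import all_fingroup cyclic.
Import GRing.Theory FinRing.Theory.
Local Open Scope ring_scope.

(** The whole statement is transported from [R] to the residue field [F] along
    the projection [f : R -> F], using the single fact that a unit of [R] is a
    [k]-th power if and only if its residue is one
    ([unit_powers_local_morphism]).  If the residue of [u] is a [k]-th power,
    dividing [u] by a lift of that power leaves an element of the group
    [1 + m]; the order of this group is [#|m|], a divisor of [#|R|] and hence
    prime to [k], so every element of [1 + m] is a [k]-th power.

    In [F], whose unit group is cyclic of order [q - 1], the [k]-th powers are
    the solutions of [x ^+ n = 1] with [n = (q - 1) / gcd (k, q - 1)]
    ([unit_powers_finFieldE]).  This turns part (a) into a parity question
    about [n] ([expr_N1_finField]).  Part (b) reduces to part (a): the
    connection set is a multiplicative group, so it is symmetric exactly when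
    it contains [-1] ([undirectedE]).

    For part (c), a Cayley graph on a finite abelian group is connected exactly
    when the connection set generates the group ([cayley_connected_gen]), and
    generation can be tested in [F] because the subgroup generated by the
    [k]-th powers of [R] contains [m] ([gen_preimset_full]).  In [F], the
    additive group spanned by the [n]-th roots of unity has [p ^ a] elements
    and is stable under multiplication by a primitive [n]-th root of unity,
    which forces [n] to divide [p ^ a - 1]; conversely, if [n] divides
    [p ^ a - 1], the span lies in the subfield of the solutions of
    [x ^+ (p ^ a) = x] ([gen_unity_roots]). *)

(** * Units and powers of units *)

(** This is Lagrange's theorem in a form that requires no group structure on
    [S]: multiplication by [u] permutes [S], so it does not change the product
    of the elements of [S], while it multiplies it by [u ^+ #|S|]. *)
Lemma expr_card_stable (R : finComNzRingType) (S : {set R}) (u : R) :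
    GRing.lreg u -> {in S, forall a, GRing.lreg a} ->
    {in S, forall a, u * a \in S} ->
  u ^+ #|S| = 1.
Proof.
move=> ureg Sreg uS.
have imS : [set u * a | a in S] = S.
  apply/eqP; rewrite eqEcard card_imset // leqnn andbT.
  by apply/subsetP=> _ /imsetP[a aS ->]; apply: uS.
have Preg : GRing.lreg (\prod_(a in S) a).
  elim/big_ind: _ => [|x y|a]; [exact: lreg1 | exact: lregM | exact: Sreg].
apply: Preg; rewrite mulr1 -[RHS]/(\prod_(a in S) a) -{3}imS.
rewrite big_imset /=; last by move=> a b _ _; apply: ureg.
by rewrite big_split /= prodr_const mulrC.
Qed.

Lemma is_unit_lreg (A : comPzRingType) (x : A) : is_unit x -> GRing.lreg x.
Proof.
by case=> y yx a b eq_xab; rewrite -[a]mul1r -[b]mul1r -yx -!mulrA eq_xab.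
Qed.

Lemma is_unitM (A : comPzRingType) (x y : A) :
  is_unit x -> is_unit y -> is_unit (x * y).
Proof.
by case=> a ax [b b1]; exists (b * a); rewrite -mulrA (mulrA a) ax mul1r.
Qed.

Lemma is_unit_fieldE (F : fieldType) (x : F) : is_unit x <-> x != 0.
Proof.
split=> [[y yx]|x0]; last by exists x^-1; rewrite mulVf.
by apply: contra_eqN yx => /eqP->; rewrite mulr0 eq_sym oner_eq0.
Qed.

Lemma unit_powers1 (A : comPzRingType) k : unit_powers k (1 : A).
Proof. by exists 1; [exists 1; rewrite mulr1 | rewrite expr1n]. Qed.

Lemma unit_powersM (A : comPzRingType) k (u v : A) :
  unit_powers k u -> unit_powers k v -> unit_powers k (u * v).
Proof.
move=> [x xu ->] [y yu ->]; exists (x * y); first exact: is_unitM.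
by rewrite exprMn.
Qed.

Lemma unit_powers_rmorph {A B : comNzRingType} (f : {rmorphism A -> B}) k u :
  unit_powers k u -> unit_powers k (f u).
Proof.
case=> x [y yx] ->; exists (f x); last by rewrite rmorphXn.
by exists (f y); rewrite -rmorphM yx rmorph1.
Qed.

(** The [k]-th powers of units form a multiplicative group, which is stable
    under negation exactly when it contains [-1]. *)
Lemma undirectedE (A : comPzRingType) k :
  gpaley_undirected A k <-> unit_powers k (-1 : A).
Proof.
split=> [und | neg x].
  by have [u uU one] := (und 1).1 (unit_powers1 A k); rewrite one opprK.
split=> [xU | [u uU ->]]; last by rewrite -mulN1r; apply: unit_powersM.
by exists (- x); rewrite ?opprK // -mulN1r; apply: unit_powersM.
Qed.

(** The fibre [S] of [f] over 1 is a multiplicative group and a translate of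
    the kernel; its order is therefore prime to [k] and each of its elements is
    a [k]-th power.  A unit whose image is a [k]-th power differs from a [k]-th
    power by a factor in [S]. *)
Lemma unit_powers_local_morphism (R : finComNzRingType) (A : comNzRingType)
    (f : {rmorphism R -> A}) k u :
    (forall x, is_unit (f x) -> is_unit x) -> (forall y, exists x, f x = y) ->
    coprime k #|R| ->
  unit_powers k u <-> unit_powers k (f u).
Proof.
move=> floc fsurj co; split=> [|[y yU fu]]; first exact: unit_powers_rmorph.
have k_gt0 : (0 < k)%N.
  by case: k co {fu} => //; rewrite /coprime gcd0n => /eqP R1;
     have := card_finNzRing_gt1 R; rewrite R1.
have [x fx] := fsurj y; have [x' x'x] : is_unit x by apply: floc; rewrite fx.
pose w := u * x' ^+ k.
have fw : f w = 1.
  by rewrite rmorphM rmorphXn fu -fx -exprMn -rmorphM mulrC x'x rmorph1 expr1n.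
pose S := [set v | f v == 1]; pose K := [set z | f z == 0].
have unitS v : f v = 1 -> is_unit v.
  by move=> fv; apply: floc; rewrite fv; exists 1; rewrite mulr1.
have wS : w ^+ #|S| = 1.
  apply: expr_card_stable => [|a|a]; first exact/is_unit_lreg/unitS.
    by rewrite inE => /eqP fa; exact/is_unit_lreg/unitS.
  by rewrite !inE rmorphM fw mul1r.
have cardS : #|S| = #|K|.
  rewrite -(card_imset K (addrI 1)); apply: eq_card => v.
  apply/idP/imsetP => [|[z]]; rewrite inE => /eqP fv; last first.
    by move=> ->; rewrite inE rmorphD rmorph1 fv addr0.
  by exists (v - 1); rewrite ?inE ?rmorphB ?rmorph1 ?fv ?subrr // addrC subrK.
have Kgroup : group_set K.
  apply/group_setP; split=> [|a b]; first by rewrite inE rmorph0.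
  by rewrite !inE zmodMgE rmorphD => /eqP-> /eqP->; rewrite addr0.
have coS : coprime k #|S|.
  apply: coprime_dvdr co; rewrite cardS -cardsT.
  exact: (cardSg (subsetT (Group Kgroup))).
(* As [c * k] is 1 modulo [#|S|], [w ^+ c] is a [k]-th root of [w]. *)
have [c d cd _] := egcdnP #|S| k_gt0.
have wc : w = (w ^+ c) ^+ k.
  by rewrite -exprM cd (eqP coS) exprD expr1 mulnC exprM wS expr1n mul1r.
exists (x * w ^+ c).
  by apply: floc; rewrite rmorphM rmorphXn fw expr1n mulr1 fx.
by rewrite exprMn -wc mulrCA -exprMn (mulrC x) x'x expr1n mulr1.
Qed.

(** * Units of a finite local ring *)

(** Finiteness replaces Zorn's lemma: being an ideal is decidable on [{set R}],
    so a maximal set with this property exists. *)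
Lemma exists_maximal_ideal (R : finComNzRingType) (I : {pred R}) :
  idealr_closed I -> exists2 J : {pred R}, maximal_ideal J & {subset I <= J}.
Proof.
pose P (A : {set R}) := [&& 0 \in A, 1 \notin A &
  [forall a, forall u in A, forall v in A, a * u + v \in A]].
have idealP (A : {set R}) : reflect (idealr_closed [in A]) (P A).
  apply: (iffP and3P) => -[A0 A1 AD]; split=> //.
    move=> a u v uA vA.
    by move/forallP/(_ a)/forall_inP/(_ u uA)/forall_inP: AD; apply.
  apply/forallP=> a; apply/forall_inP=> u uA; apply/forall_inP=> v vA.
  exact: AD.
have ideal_set (J : {pred R}) : idealr_closed J -> P [set x in J].
  case=> J0 J1 JD; apply/idealP; split; rewrite ?inE // => a u v.
  by rewrite !inE; apply: JD.
move=> /ideal_set /maxset_exists[M /maxsetP[/idealP Mid Mmax] /subsetP IM].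
exists [in M] => [|x xI]; last by apply: IM; rewrite inE.
split=> // J /ideal_set Jid MJ x; rewrite -[in RHS](Mmax _ Jid) ?inE //.
by apply/subsetP=> y yM; rewrite inE; apply: MJ.
Qed.

(** The multiples of a non-unit [x] form a proper ideal, which lies in a maximal
    one; as [m] is the only maximal ideal, [x] belongs to [m]. *)
Lemma local_ring_unit (R : finComNzRingType) (m : {pred R}) x :
  local_ring m -> x \notin m -> is_unit x.
Proof.
move=> [_ muniq] xm.
case: (boolP [exists y, y * x == 1]) => [/existsP[y /eqP yx] | nox].
  by exists y.
have : idealr_closed [pred z | [exists y, y * x == z]].
  split=> [||a u v /existsP[b /eqP<-] /existsP[c /eqP<-]] //.
    by apply/existsP; exists 0; rewrite mul0r.
  by apply/existsP; exists (a * b + c); rewrite mulrDl mulrA.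
case/exists_maximal_ideal=> J Jmax xJ; case/negP: xm.
rewrite -(muniq J Jmax) xJ //; apply/existsP; exists 1; by rewrite mul1r.
Qed.

(** * Powers in a finite field *)

Lemma expf_card_sub1 (F : finFieldType) (x : F) :
  x != 0 -> x ^+ (#|F| - 1) = 1.
Proof.
move=> x0; apply: (mulfI x0); rewrite -exprS mulr1 -[RHS]expf_card.
by rewrite -add1n subnKC // ltnW // card_finNzRing_gt1.
Qed.

Lemma finField_prim_root (F : finFieldType) :
  exists z : F, (#|F| - 1).-primitive_root z.
Proof.
have N_gt0 : (0 < #|F| - 1)%N by rewrite subn_gt0 card_finNzRing_gt1.
have /hasP[z _ zP] : has (#|F| - 1).-primitive_root (enum (predC1 (0 : F))).
  apply: has_prim_root; rewrite ?enum_uniq // -?cardE ?cardC1 ?subn1 //.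
  apply/allP=> x; rewrite mem_enum /= => x0; apply/unity_rootP.
  by move: x0; rewrite -subn1 inE; apply: expf_card_sub1.
by exists z.
Qed.

(** In a cyclic group of order [N], the subgroup of [k]-th powers is the one of
    order [N / gcd (k, N)], and a subgroup of a cyclic group is cut out by the
    equation that its order imposes. *)
Lemma unit_powers_finFieldE (F : finFieldType) k (x : F) :
  unit_powers k x <-> x ^+ ((#|F| - 1) %/ gcdn k (#|F| - 1)) = 1.
Proof.
set N := (#|F| - 1)%N; set g := gcdn k N.
have N_gt0 : (0 < N)%N by rewrite subn_gt0 card_finNzRing_gt1.
have gN : (g %| N)%N := dvdn_gcdr k N.
have [z zP] := finField_prim_root F; rewrite -/N in zP.
have expN (y : F) : y != 0 -> y ^+ N = 1 := @expf_card_sub1 F y.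
(* Left transparent, [N] is unfolded by conversion, which then compares large
   cardinality terms. *)
clearbody N.
split=> [[y /is_unit_fieldE y0 ->] | xn].
  have /dvdnP[c kc] : (g %| k)%N := dvdn_gcdl k N.
  by rewrite {1}kc -exprM -mulnA mulnC (mulnC g) divnK // exprM expN // expr1n.
have xN : x ^+ N = 1 by rewrite -(divnK gN) exprM xn expr1n.
have [i xi] := prim_rootP zP xN.
have /dvdnP[j ij] : (g %| i)%N.
  move/eqP: xn; rewrite xi -exprM -(prim_order_dvd zP) -{1}(divnK gN) mulnC.
  by rewrite dvdn_pmul2r ?divn_gt0 ?(dvdn_leq N_gt0) // gcdn_gt0 N_gt0 orbT.
(* Bezout gives [g + a * k = 0] modulo [N], hence [z ^+ g = (z ^- a) ^+ k]. *)
have [a _] := Bezoutl k N_gt0; rewrite gcdnC (prim_order_dvd zP) exprD => /eqP za.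
have z0 : z != 0 by rewrite (prim_root_eq0 zP) gtn_eqF.
exists (z ^- (a * j)); first by apply/is_unit_fieldE; rewrite invr_eq0 expf_neq0.
have zg : z ^+ g = (z ^- a) ^+ k.
  rewrite exprVn -exprM; apply/(mulIf (expf_neq0 (a * k) z0)).
  by rewrite za mulVf ?expf_neq0.
by rewrite xi ij mulnC exprM zg exprAC exprVn -exprM.
Qed.

(** In odd characteristic [(-1) ^+ n = 1] says that [n = N / g] is even, where
    [N = #|F| - 1]; as [N] is even too, this is the same as [g] dividing
    [N / 2].  In characteristic 2, [-1 = 1]. *)
Lemma expr_N1_finField (F : finFieldType) g : (g %| #|F| - 1)%N ->
  (-1 : F) ^+ ((#|F| - 1) %/ g) = 1 <->
  ~~ odd #|F| \/ (odd #|F| /\ (g %| (#|F| - 1) %/ 2)%N).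
Proof.
move=> g_dvd; have F_gt1 := card_finNzRing_gt1 F.
have N1_N : (-1 : F) ^+ (#|F| - 1) = 1.
  by apply: expf_card_sub1; rewrite oppr_eq0 oner_eq0.
case: (boolP (odd #|F|)) => oddF; last first.
  split=> [_|_]; first by left.
  (* [(-1) ^+ N = 1] by Fermat's little theorem, with [N] odd. *)
  have -> : -1 = 1 :> F.
    by rewrite -[RHS]N1_N -signr_odd oddB ?(ltnW F_gt1) // (negPf oddF).
  by rewrite expr1n.
have N1_neq1 : -1 != 1 :> F.
  (* If [-1 = 1], then 1 has additive order 2, which divides [#|F|]. *)
  apply/eqP=> N1_1; have ord1 : #[1%R : F]%g = 2%N.
    apply: nt_prime_order => //; last by rewrite zmod1gE oner_eq0.
    by rewrite zmodXgE zmod1gE mulr2n -{1}N1_1 addNr.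
  by have := order_dvdG (in_setT (1 : F)); rewrite ord1 cardsT dvdn2 oddF.
have N_even : (2 %| #|F| - 1)%N by rewrite dvdn2 oddB ?(ltnW F_gt1) // oddF.
rewrite -signr_odd; have -> : (g %| (#|F| - 1) %/ 2)%N = ~~ odd ((#|F| - 1) %/ g).
  by rewrite -dvdn2 !dvdn_divRL // mulnC.
case: (odd _) => /=; last by split=> // _; right.
by rewrite expr1; split=> [/eqP|[|[]]] //; rewrite (negPf N1_neq1).
Qed.

(** * Connectedness *)

(** The vertices reachable from 0 are the sums of elements of [A].  In a finite
    group these already form the subgroup generated by [A], so that directed
    walks suffice to reach everything that [A] generates. *)
Lemma cayley_connected_gen (V : finZmodType) (S : V -> Prop) (A : {set V}) :
    (forall x, S x <-> x \in A) ->
  strongly_connected (cayley S) <-> <<A>>%g = [set: V].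
Proof.
move=> SA; split=> [conn | genA v w].
  apply/setP=> w; rewrite inE; have: 0 \in <<A>>%g := group1 _.
  elim: (conn 0 w) => // [x y /SA xyA xA | x y z _ IHx _ IHy /IHx/IHy //].
  by rewrite -(subrK x y) addrC -zmodMgE groupM // mem_gen.
have /gen_prodgP[n [c cA wv]] : w - v \in <<A>>%g by rewrite genA inE.
have {wv} -> : w = v + \sum_i c i by rewrite -[\sum_i _]wv addrC subrK.
elim: n c cA => [|n IHn] c cA; first by rewrite big_ord0 addr0; apply: rt_refl.
rewrite big_ord_recr addrA /=.
apply: rt_trans (IHn (fun i => c (widen_ord (leqnSn n) i)) (fun i => cA _)) _.
apply: rt_step; rewrite /cayley [_ + c _]addrC addrK; exact/SA/cA.
Qed.

(** For [z] in the kernel, [1 + z] and [1] both have image 1, so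
    [z = (1 + z) - 1] is in the subgroup generated by the preimage of [U].
    Since this subgroup contains the kernel, it is the preimage of its image,
    which is the subgroup generated by [U]. *)
Lemma gen_preimset_full (R A : finNzRingType) (f : {rmorphism R -> A})
    (U : {set A}) :
    (forall y, exists x, f x = y) -> 1 \in U ->
  <<f @^-1: U>>%g = [set: R] <-> <<U>>%g = [set: A].
Proof.
move=> f_surj U1.
have fM : {in [set: R] &, {morph f : x y / (x * y)%g >-> (x * y)%g}}.
  by move=> x y _ _; apply: rmorphD.
pose fg := Morphism fM.
have preE (B : {set A}) : (fg @*^-1 B)%g = f @^-1: B by apply: setTI.
have fgT : (fg @* [set: R])%g = [set: A].
  apply/setP=> y; rewrite inE; have [x <-] := f_surj y.
  exact: (mem_morphim fg).
have im_gen : (fg @* <<f @^-1: U>>)%g = <<U>>%g.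
  by rewrite morphim_gen ?subsetT // -preE morphpreK // fgT subsetT.
have ker_sub : ('ker fg \subset <<f @^-1: U>>)%g.
  apply/subsetP=> z /mker /= fz.
  have -> : z = ((1%R : R)^-1 * (1 + z)%R)%g by rewrite zmodMgE zmodVgE addKr.
  rewrite groupM ?groupV // mem_gen // inE ?rmorphD rmorph1 //.
  by rewrite [f z]fz zmod1gE addr0.
split=> [genR | genA]; first by rewrite -im_gen genR fgT.
by rewrite -(morphimGK ker_sub (subsetT _)) /= im_gen genA preE preimsetT.
Qed.

(** If [n] divides [p ^ a - 1], all [n]-th roots of unity are fixed by the
    additive map [x |-> x ^+ (p ^ a)]; if they generate [F], then so is a
    generator [z] of the unit group, and [a] cannot be smaller than [e].
    Conversely let [T] be the additive span of the [n]-th roots of unity.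
    Multiplication by a primitive [n]-th root of unity [w] permutes the nonzero
    elements of [T], so [n] divides [#|T| - 1 = p ^ a - 1] by Lagrange's
    theorem, and primitivity leaves only [a = e]. *)
Lemma gen_unity_roots (F : finFieldType) (p e n : nat) :
    prime p -> #|F| = (p ^ e)%N -> (n %| p ^ e - 1)%N ->
  <<[set x : F | (x ^+ n == 1)%R]>>%g = [set: F] <-> primitive_divisor n p e.
Proof.
move=> p_pr cardF n_dvd; have [z] := finField_prim_root F; rewrite cardF => zP.
have p_gt1 := prime_gt1 p_pr.
have z0 : z != 0 by rewrite (prim_root_eq0 zP) gtn_eqF // (prim_order_gt0 zP).
set U := [set x | _]; split=> [genU | [_ n_prim]].
  split=> // a /andP[a_gt0 a_lt]; apply/negP=> n_dvd_a.
  pose E := [set x : F | x ^+ (p ^ a) == x].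
  have Egroup : group_set E.
    apply/group_setP; split=> [|x y].
      by rewrite inE expr0n expn_eq0 (gtn_eqF (prime_gt0 p_pr)).
    rewrite !inE zmodMgE exprDn_pchar; first by move=> /eqP-> /eqP->.
    by rewrite pnatX pnatE // (card_finPcharP cardF).
  have /subsetP sUE : <<U>>%g \subset Group Egroup.
    rewrite gen_subG; apply/subsetP=> x; rewrite !inE => /eqP xn.
    have /dvdnP[c pc] := n_dvd_a.
    have -> : (p ^ a = (p ^ a - 1).+1)%N.
      by rewrite -subSn ?subn1 // expn_gt0 ltnW.
    by rewrite exprS pc mulnC exprM xn expr1n mulr1.
  have := sUE z; rewrite genU !inE => /(_ isT) /eqP zpa.
  have p_a_gt0 : (0 < p ^ a - 1)%N by rewrite subn_gt0 -(expn0 p) ltn_exp2l.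
  have : (p ^ e - 1 %| p ^ a - 1)%N.
    rewrite (prim_order_dvd zP); apply/eqP/(mulfI z0).
    by rewrite -exprS mulr1 -add1n subnKC ?zpa // expn_gt0 prime_gt0.
  move/(dvdn_leq p_a_gt0); rewrite leqNgt ltn_sub2r ?ltn_exp2l //.
  by rewrite -(expn0 p) ltn_exp2l // (leq_ltn_trans _ a_lt).
set T := <<U>>%g.
have [a a_le cardT] : exists2 a, (a <= e)%N & #|T| = (p ^ a)%N.
  by apply/(dvdn_pfactor _ _ p_pr); rewrite -cardF -cardsT; apply/cardSg/subsetT.
pose w := z ^+ ((p ^ e - 1) %/ n).
have wP : n.-primitive_root w := dvdn_prim_root zP n_dvd.
have w0 : w != 0 by rewrite expf_neq0.
have wT : {in T :\ 0, forall t, w * t \in T :\ 0}.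
  move=> t; rewrite !in_setD1 mulf_eq0 (negPf w0) => /andP[-> /=].
  case/gen_prodgP=> r [c cU ->]; apply/gen_prodgP; exists r.
  exists (fun i => w * c i) => [i|]; last exact: mulr_sumr.
  by have := cU i; rewrite !inE exprMn (prim_expr_order wP) mul1r.
have : w ^+ #|T :\ 0| = 1.
  apply: expr_card_stable => // [|t]; first exact/lregP.
  by rewrite in_setD1 => /andP[t0 _]; apply/lregP.
have T0 : 0 \in T := group1 _; have T1 : 1 \in T by rewrite mem_gen // inE expr1n.
have cardT0 : #|T :\ 0| = (p ^ a - 1)%N.
  by rewrite -cardT (cardsD1 0 T) T0 addKn.
rewrite cardT0 => /eqP; rewrite -(prim_order_dvd wP) => n_dvd_a.
have a_gt0 : (0 < a)%N.
  rewrite lt0n; apply/eqP=> a0; have := subset_leq_card (_ : [set 0; 1] \subset T).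
  rewrite cards2 eq_sym oner_eq0 cardT a0 => /(_ _)/negP; case=> //.
  by apply/subsetP=> x /set2P[] ->.
have a_e : a = e.
  apply/eqP; rewrite eqn_leq a_le leqNgt; apply/negP=> a_lt.
  by have /negP := n_prim a (introT andP (conj a_gt0 a_lt)).
by apply/eqP; rewrite eqEcard subsetT cardsT cardF cardT a_e /=.
Qed.

(** * The transfer to the residue field *)

Theorem corollary2p5
  (R : finComNzRingType) (m : idealr R) (hloc : local_ring (m : {pred R}))
  (p e q : nat) (hp : prime p) (he : (0 < e)%N) (hq : q = (p ^ e)%N)
  (F : finFieldType) (hF : #|F| = q)
  (phi : {rmorphism {ideal_quot m} -> F}) (hphi : bijective phi)
  (k : nat) (hk : coprime k #|R|) :
  ((unit_powers k (-1 : R) <-> unit_powers k (-1 : {ideal_quot m})) /\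
   (unit_powers k (-1 : R) <->
      ~~ odd q \/ (odd q /\ (gcdn k (q - 1) %| (q - 1) %/ 2)%N))) /\
  (gpaley_undirected R k <-> gpaley_undirected {ideal_quot m} k) /\
  (strongly_connected (@gpaley R k) <->
     primitive_divisor ((q - 1) %/ gcdn k (q - 1)) p e).
Proof.
(* [f] sends [m] to 0, so that an element with nonzero residue is outside [m]
   and hence a unit. *)
pose pi : {rmorphism R -> {ideal_quot m}} := \pi_({ideal_quot m})%qT.
pose f : {rmorphism R -> F} := phi \o pi.
have f_surj y : exists x, f x = y.
  have [psi _ psiK] := hphi; exists (generic_quotient.repr (psi y)).
  by rewrite /f /= reprK psiK.
have f_local x : is_unit (f x) -> is_unit x.
  move/is_unit_fieldE=> fx0; apply: local_ring_unit hloc _.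
  apply: contra_neqN fx0; rewrite -[x in x \in _]subr0 Quotient.idealrBE => /eqP.
  by rewrite /f /= => ->; rewrite !rmorph0.
have cardF : #|F| = (p ^ e)%N by rewrite hF.
have power_lift u : unit_powers k u <-> unit_powers k (f u).
  exact: unit_powers_local_morphism.
have powerE u : unit_powers k u <-> f u ^+ ((q - 1) %/ gcdn k (q - 1)) = 1.
  rewrite -hF; apply: iff_trans (power_lift u) _.
  exact: unit_powers_finFieldE.
have N1_quot : unit_powers k (-1 : R) <-> unit_powers k (-1 : {ideal_quot m}).
  split=> [/(unit_powers_rmorph pi)|/(unit_powers_rmorph phi)].
    by rewrite rmorphN1.
  by rewrite rmorphN1 => N1F; apply/power_lift; rewrite rmorphN1.
split; [split=> // | split].
- apply: iff_trans (powerE _) _; rewrite rmorphN1 -hF.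
  exact/expr_N1_finField/dvdn_gcdr.
- by apply: iff_trans (undirectedE _ _) (iff_trans N1_quot (iff_sym (undirectedE _ _))).
set n := (_ %/ _)%N in powerE *; set U := [set x : F | x ^+ n == 1].
have n_dvd : (n %| p ^ e - 1)%N by rewrite -hq dvdn_div // dvdn_gcdr.
apply: iff_trans (gen_unity_roots _ _ _ _ hp cardF n_dvd).
apply: iff_trans (@cayley_connected_gen _ _ (f @^-1: U) _) _ => [x|].
  by rewrite !inE; split=> [/powerE-> //|/eqP/powerE //].
by apply: gen_preimset_full => //; rewrite inE expr1n.
Qed.
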